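(* Let $p$ be an odd prime and $G=D_{2p}$. The set of nonzero values of the group determinant $\mathscr{D}_G$ at integer arguments is exactly the set of integers of the form $2^a p^b m$, where $m$ is any integer with $\gcd(m,2p)=1$, $a,b$ are nonnegative integers, $a=0$ or $a\ge 2$, and $b=0$ or $b\ge 3$.
   Context: For a finite group $G=\{g_1,\ldots,g_N\}$ and variables $x_g$ ($g\in G$), the group determinant is the $N\times N$ determinant $\mathscr{D}_G(x_{g_1},\ldots,x_{g_N})=\det\left(x_{g_ig_j^{-1}}\right)_{1\le i,j\le N}$; integer arguments means $(x_{g_1},\ldots,x_{g_N})\in\mathbb{Z}^N$. $D_{2n}=\langle R,F \mid R^n=1,\ F^2=1,\ RF=FR^{n-1}\rangle$ denotes the dihedral group of order $2n$. *)

(* Defs.v *)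
From mathcomp Require Import all_boot all_order all_algebra all_fingroup all_solvable.

Set Implicit Arguments.
Unset Strict Implicit.
Unset Printing Implicit Defensive.

Import GRing.Theory.
Local Open Scope ring_scope.

(* The group elements are listed in the order of [enum gT]. Another order
   permutes rows and columns simultaneously, so the determinant is the same. *)
Definition group_det (R : comNzRingType) (gT : finGroupType) (x : gT -> R) : R :=
  \det (\matrix_(i < #|gT|, j < #|gT|)
          x (enum_val i * (enum_val j)^-1)%g).

(* The library presents 'D_(2 * n) with the relation R ^ F = R^-1; this is the
   relation R F = F R^(n-1). *)
Lemma dihedral_presentation (n : nat) : (1 < n)%N ->
  ([set: 'D_(2 * n)] \isog
     Grp (R : F : R ^+ n, F ^+ 2, R * F = F * R ^+ n.-1))%g.
Proof.
move=> n_gt1; rewrite mul2n => gT G; rewrite Grp_dihedral //.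
apply/existsP/existsP=> [] [[r f]] /=.
  case/eqP=> <- rn f2 rf; exists (r, f); rewrite /= !xpair_eqE rn f2 !eqxx /=.
  have <- : (r^-1 = r ^+ n.-1)%g.
    by apply/eqP; rewrite eq_invg_mul -expgS (ltn_predK n_gt1) rn.
  by rewrite (conjgC r) rf.
case/eqP=> <- rn f2 rf; exists (r, f); rewrite /= !xpair_eqE rn f2 !eqxx /=.
by rewrite conjgE rf mulKg eq_sym eq_invg_mul -expgS (ltn_predK n_gt1) rn.
Qed.

(* Main.v *)
Require Import Defs.
From mathcomp Require Import all_boot all_order all_algebra all_fingroup all_solvable.
From mathcomp Require Import all_field zify ring.
Set Implicit Arguments.
Unset Strict Implicit.
Unset Printing Implicit Defensive.
Import GRing.Theory Num.Theory.
Local Open Scope ring_scope.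

(** Write a_i = x(R^i), b_i = x(R^i F), and let f, g be the polynomials with
    coefficients a_i, b_i. Listing the rotations before the reflections, the
    group matrix is a 2 x 2 block matrix with diagonal blocks A = (a_(i-j)) and
    off-diagonal blocks B = (b_(i+j)). This gives two expressions for the
    determinant D, one for each direction.

    Necessity. D = det(A + B) det(A - B) by block operations. Modulo 2 the two
    factors agree, so D even forces 4 | D. Put s = f(1) and t = g(1). The row
    sums of A + B and of A - B are s + t and s - t, so det(A + B) = (s + t) M
    and det(A - B) = (s - t) M' for integers M, M' ([det_row_sum]). Modulo p the
    matrices A + B and A - B act on the functions on Z/p, and they are
    triangular in the basis of monomials i^k, with diagonal entries s + t and s
    - t in alternation; hence p divides M if and only if it divides s^2 - t^2,
    and the same holds for M' ([det_reflection_minor_charp],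
    [dvdz_reflection_minor]). If p | D then p divides each of s^2 - t^2, M and
    M', so p^3 | D.

    Sufficiency. Over the complex numbers the discrete Fourier transform turns
    the blocks into diagonal matrices ([det_dihedral_fourier]), so that D is the
    product of h(y) = f(y) f(1/y) - g(y) g(1/y) over the p-th roots of unity y.
    Adding multiples of 1 + X + ... + X^(p-1) to f and g leaves h(y) unchanged
    for y <> 1, while f(1) and g(1) run over full residue classes mod p: D can
    be given any value (s^2 - t^2) N with s congruent to f(1) and t to g(1)
    modulo p, where N is the product of h(y) over y <> 1 ([realize_norm]). Three
    choices of f and g, for which h is a quotient of products of factors 1 - y^c
    up to a power of y, give N = 1 or N = p^2, and yield k^2 - l^2 when it is
    prime to p, p^3 (k^2 - l^2) when k + l is prime to p, and p^4 (k^2 - l^2) in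
    all cases. It remains to recall that the differences of two squares are
    exactly the integers that are odd or divisible by 4. *)

(** * The group matrix of the dihedral group *)

Lemma expg_ordB (gT : finGroupType) q (r : gT) (i j : 'I_q.+1) :
  (r ^+ q.+1 = 1 -> r ^+ (i - j)%R = r ^+ i * (r ^+ j)^-1)%g.
Proof.
move=> rq; apply: (mulIg (r ^+ j)%g); rewrite mulgKV -expgD.
rewrite -[LHS](expg_mod _ rq).
suff -> : (((i - j)%R + j) %% q.+1)%N = i by [].
have -> : (((i - j)%R + j) %% q.+1)%N = val (i - j + j) by [].
by rewrite subrK.
Qed.

(** The words r^i f^b are closed under multiplication, so they exhaust the
    group; as there are 2p of them, they are pairwise distinct. *)
Lemma dihedral_elements q : (0 < q)%N ->
  exists r f : 'D_(2 * q.+1),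
    [/\ r ^+ q.+1 = 1, f ^+ 2 = 1, r ^ f = r^-1 &
        bijective (fun u : 'I_q.+1 * bool => r ^+ u.1 * f ^+ u.2)]%g.
Proof.
move=> q_gt0; have n_gt1 : (1 < q.+1)%N by [].
have := homg_refl [set: 'D_(2 * q.+1)]%G.
have := Grp_dihedral n_gt1; rewrite -mul2n => iso.
rewrite iso => /existsP[[r f]] /=; rewrite !xpair_eqE.
case/andP=> /eqP gen /and3P[/eqP rq /eqP f2 /eqP rf].
exists r, f; split=> //; set e := fun _ => _.
have fE : (f^-1 = f)%g by apply/eqP; rewrite eq_invg_mul -expg2 f2.
have codomE : codom e =i predT.
  have eP i b : (e (i, b) = r ^+ i * f ^+ b)%g by [].
  pose H := [set x in codom e].
  have HP x : reflect (exists i b, x = r ^+ i * f ^+ nat_of_bool b)%g (x \in H).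
    rewrite inE; apply: (iffP codomP) => [[[i b] ->]|[i [b ->]]].
      by exists i, b.
    have hi : (i %% q.+1 < q.+1)%N by rewrite ltn_mod.
    by exists (Ordinal hi, b); rewrite eP /= (expg_mod i rq).
  have frn k : (f * r ^+ k = (r ^+ k)^-1 * f)%g.
    by rewrite -expVgn -rf -conjXg conjgE !mulgA fE -(mulgA _ f) -expg2 f2 mulg1.
  have gH : group_set H.
    apply/group_setP; split.
      by apply/HP; exists 0%N, false; rewrite !expg0 mulg1.
    move=> x y /HP[i [b ->]] /HP[j [c ->]]; apply/HP; case: b => /=.
      exists (i + (q.+1 - j %% q.+1))%N, (~~ c).
      have rjV : ((r ^+ j)^-1 = r ^+ (q.+1 - j %% q.+1))%g.
        apply/eqP; rewrite eq_invg_mul -{1}(expg_mod j rq) -expgD.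
        by rewrite subnKC ?rq // ltnW // ltn_mod.
      rewrite expg1 expgD -rjV -!mulgA; congr (_ * _)%g.
      rewrite mulgA frn -mulgA; congr (_ * _)%g.
      by case: c; rewrite /= ?expg1 ?mulg1 -?expg2.
    by exists (i + j)%N, c; rewrite mulg1 mulgA -expgD.
  have: [set: 'D_(2 * q.+1)]%g \subset Group gH.
    rewrite -gen join_subG !cycle_subG; apply/andP; split; apply/HP.
      by exists 1%N, false; rewrite expg1 mulg1.
    by exists 0%N, true; rewrite expg1 mul1g.
  by move/subsetP=> sub x; have := sub x (in_setT x); rewrite inE inE => ->.
apply: inj_card_bij; last first.
  by rewrite -cardsT mul2n card_dihedral // card_prod card_bool card_ord muln2.
apply/injectiveP/card_uniqP; rewrite size_map -cardE (eq_card codomE).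
by rewrite -cardsT mul2n card_dihedral // card_prod card_bool card_ord muln2.
Qed.

Lemma group_det_reindex (R : comNzRingType) (gT : finGroupType) (n : nat)
    (e : 'I_n -> gT) (x : gT -> R) : bijective e ->
  group_det x = \det (\matrix_(i < n, j < n) x (e i * (e j)^-1)%g).
Proof.
move=> e_bij; have eqn : #|gT| = n by rewrite -(bij_eq_card e_bij) card_ord.
rewrite /group_det; case: n / eqn e e_bij => e [e' eK e'K].
have s_inj : injective (fun i : 'I_#|gT| => e' (enum_val i)).
  by move=> i j /(can_inj e'K) /enum_val_inj.
set A := (X in _ = \det X); pose s := perm s_inj.
have -> : (\matrix_(i < #|gT|, j < #|gT|) x (enum_val i * (enum_val j)^-1)%g)
    = row_perm s (col_perm s A).
  by apply/matrixP=> i j; rewrite !mxE !permE !e'K.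
rewrite row_permE col_permE !det_mulmx !det_perm odd_permV.
by rewrite mulrCA -signr_addb addbb mulr1.
Qed.

Definition circ_mx (R : nmodType) q (a : 'I_q.+1 -> R) : 'M[R]_q.+1 :=
  \matrix_(i, j) a (i - j).
Definition anticirc_mx (R : nmodType) q (b : 'I_q.+1 -> R) : 'M[R]_q.+1 :=
  \matrix_(i, j) b (i + j).

Definition dihedral_mx (R : nmodType) q (a b : 'I_q.+1 -> R) :=
  block_mx (circ_mx a) (anticirc_mx b) (anticirc_mx b) (circ_mx a).

(** Since r^i f (r^j)^-1 = r^(i+j) f, the entries that mix rotations and
    reflections depend on the sum of the indices, the others on the
    difference. *)
Lemma group_det_dihedral (R : comNzRingType) q (D : R) : (0 < q)%N ->
  (exists x : 'D_(2 * q.+1) -> R, group_det x = D) <->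
  (exists a b : 'I_q.+1 -> R, \det (dihedral_mx a b) = D).
Proof.
move=> /dihedral_elements[r [f [rq f2 rf [e' eK e'K]]]].
have fE : (f^-1 = f)%g by apply/eqP; rewrite eq_invg_mul -expg2 f2.
have frn k : (f * (r ^+ k)^-1 = r ^+ k * f)%g.
  by rewrite -expVgn -rf -conjXg conjgE !mulgA mulgV mul1g.
pose e (i : 'I_(q.+1 + q.+1)) :=
  match split i with inl j => r ^+ j | inr j => r ^+ j * f end%g.
have e_bij : bijective e.
  exists (fun g => unsplit (if (e' g).2 then inr (e' g).1 else inl (e' g).1)).
    move=> i; rewrite -[i in RHS]splitK /e; case: (split i) => j.
      by have := eK (j, false); rewrite /= mulg1 => ->.
    by have := eK (j, true); rewrite /= expg1 => ->.
  move=> g; rewrite /e unsplitK -[g in RHS]e'K.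
  by case: (e' g) => i []; rewrite /= ?expg1 ?mulg1.
have detE (x : 'D_(2 * q.+1) -> R) : group_det x =
    \det (dihedral_mx (fun i : 'I_q.+1 => x (r ^+ i)%g)
                      (fun i : 'I_q.+1 => x (r ^+ i * f)%g)).
  rewrite (group_det_reindex _ e_bij). congr (\det _); apply/matrixP=> i j.
  have rD (s t : 'I_q.+1) : (r ^+ (s + t)%R = r ^+ s * r ^+ t)%g.
    by rewrite -expgD -[RHS](expg_mod _ rq).
  rewrite !mxE /e; case: (split i) => s; rewrite !mxE;
    case: (split j) => t; rewrite !mxE.
  - by rewrite expg_ordB.
  - by rewrite invMg fE -[(r ^+ s * _)%g]/(r ^+ s * (f * (r ^+ t)^-1))%g frn rD mulgA.
  - by rewrite -mulgA frn rD mulgA.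
  - by rewrite expg_ordB // invMg !mulgA mulgK.
split=> [[x <-]|[a [b <-]]].
  by exists (fun i : 'I_q.+1 => x (r ^+ i)%g),
            (fun i : 'I_q.+1 => x (r ^+ i * f)%g).
exists (fun g => if (e' g).2 then b (e' g).1 else a (e' g).1); rewrite detE.
congr (\det _); congr block_mx; apply/matrixP=> i j; rewrite !mxE.
- by have := eK (i - j, false); rewrite /= mulg1 => ->.
- by have := eK (i + j, true); rewrite /= expg1 => ->.
- by have := eK (i + j, true); rewrite /= expg1 => ->.
- by have := eK (i - j, false); rewrite /= mulg1 => ->.
Qed.

(** * Necessity: divisibility by 4 and by the cube of p *)

(** Adding the lower rows to the upper ones and then subtracting the left
    columns from the right ones makes the matrix block triangular, without the
    division by 2 that a change of basis to sums and differences would cost. *)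
Lemma det_block_mx_swap (R : comNzRingType) n (A B : 'M[R]_n) :
  \det (block_mx A B B A) = \det (A + B) * \det (A - B).
Proof.
have E : block_mx 1%:M 1%:M 0 1%:M *m block_mx A B B A *m
    block_mx 1%:M (- 1%:M) 0 1%:M = block_mx (A + B) 0 B (A - B).
  rewrite !mulmx_block !(mul1mx, mul0mx, mulmx1, mulmx0, mulmxN, addr0, add0r).
  by rewrite !(addrC B) addNr (addrC (- B)).
have := congr1 determinant E.
by rewrite !det_mulmx !det_ublock det_lblock !det1 !(mul1r, mulr1).
Qed.

(** The matrix of the permutation action of the group on Z/p, where R acts by
    translation and F by negation. *)
Definition reflection_mx (R : nmodType) q (a b : 'I_q.+1 -> R) :=
  circ_mx a + anticirc_mx b.

Lemma det_dihedral_mx (R : comNzRingType) q (a b : 'I_q.+1 -> R) :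
  \det (dihedral_mx a b) =
    \det (reflection_mx a b) * \det (reflection_mx a (fun i => - b i)).
Proof.
rewrite /dihedral_mx det_block_mx_swap; congr (_ * \det (_ + _)).
by apply/matrixP=> i j; rewrite !mxE.
Qed.

Definition col0_ones (R : nzRingType) q (P : 'M[R]_q.+1) :=
  \matrix_(i, j) if j == 0 then 1 else P i j.

(** Replacing the first column by the sum of all the columns preserves the
    determinant; the sum is s times the all-ones column. *)
Lemma det_row_sum (R : comNzRingType) q (P : 'M[R]_q.+1) s :
  (forall i, \sum_j P i j = s) -> \det P = s * \det (col0_ones P).
Proof.
move=> sumP; pose d : 'rV[R]_q.+1 := \row_j if j == 0 then s else 1.
have E : P *m col0_ones 1%:M = col0_ones P *m diag_mx d.
  rewrite mul_mx_diag; apply/matrixP=> i j; rewrite !mxE.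
  case: eqP => [->|/eqP jn0].
    by rewrite mul1r -(sumP i); apply: eq_bigr => k _; rewrite !mxE mulr1.
  rewrite mulr1 (bigD1 j) //= big1 => [|k kj]; rewrite !mxE (negPf jn0).
    by rewrite eqxx mulr1 addr0.
  by rewrite (negPf kj) mulr0.
have det_d : \det (diag_mx d) = s.
  by rewrite det_diag big_ord_recl mxE eqxx big1 ?mulr1 // => i _; rewrite mxE.
have det_1 : \det (col0_ones (1%:M : 'M[R]_q.+1)) = 1.
  rewrite det_trig => [|].
    by apply: big1 => i _; rewrite !mxE; case: ifP => // _; rewrite eqxx.
  apply/is_trig_mxP=> i j ij; rewrite !mxE -val_eqE /= gtn_eqF ?(leq_ltn_trans _ ij) //.
  by rewrite -val_eqE /= ltn_eqF.
have := congr1 determinant E.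
by rewrite !det_mulmx det_1 det_d mulr1 mulrC.
Qed.

Section SumReflection.
Variables (R : comNzRingType) (q : nat).
Implicit Types a b F : 'I_q.+1 -> R.

Lemma sum_circ a F i : \sum_j a (i - j) * F j = \sum_s a s * F (i - s).
Proof.
rewrite (reindex_inj (h := fun s => i - s)) => [|s t /addrI /oppr_inj //].
by apply: eq_bigr => s _; rewrite subKr.
Qed.

Lemma sum_anticirc b F i : \sum_j b (i + j) * F j = \sum_s b s * F (s - i).
Proof.
rewrite (reindex_inj (h := fun s => s - i)) => [|s t /addIr //].
by apply: eq_bigr => s _; rewrite addrC subrK.
Qed.

Lemma sum_reflection_mx a b F i : \sum_j reflection_mx a b i j * F j =
  \sum_s (a s * F (i - s) + b s * F (s - i)).
Proof.
rewrite big_split -sum_circ -sum_anticirc -big_split.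
by apply: eq_bigr => j _; rewrite !mxE mulrDl.
Qed.

Lemma reflection_mx_row_sum a b i :
  \sum_j reflection_mx a b i j = \sum_s a s + \sum_s b s.
Proof.
rewrite -big_split -(eq_bigr _ (fun j _ => mulr1 (reflection_mx a b i j))).
rewrite (sum_reflection_mx a b (fun=> 1)).
by apply: eq_bigr => s _; rewrite !mulr1.
Qed.

End SumReflection.

Lemma det_Vandermonde_neq0 (R : idomainType) n (x : 'I_n -> R) :
  injective x -> \det (Vandermonde n (\row_i x i)) != 0.
Proof.
move=> x_inj; rewrite det_Vandermonde prodf_seq_neq0; apply/allP=> i _ /=.
rewrite prodf_seq_neq0; apply/allP=> j _ /=; apply/implyP=> ij.
by rewrite !mxE subr_eq0 (inj_eq x_inj) -val_eqE /= gtn_eqF.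
Qed.

(** A summation range independent of the exponent lets the binomial coefficients
    be read as the entries of a square matrix. *)
Lemma exprDn_wide (R : comNzRingType) (x y : R) n k : (k < n)%N ->
  (x + y) ^+ k = \sum_(l < n) (x ^+ (k - l) * y ^+ l) *+ 'C(k, l).
Proof.
move=> k_lt_n; rewrite exprDn.
rewrite (big_ord_widen n (fun l => (x ^+ (k - l) * y ^+ l) *+ 'C(k, l))) //.
rewrite big_mkcond; apply: eq_bigr => l _; case: ltnP => // k_lt_l.
by rewrite bin_small ?mulr0n.
Qed.

Lemma binomial_term_split (R : comNzRingType) (a b x y : R) k l c :
  a * (((- y) ^+ k * x ^+ l) *+ c) + b * ((y ^+ k * (- x) ^+ l) *+ c) =
  (x ^+ l * (a * (- y) ^+ k + b * (y ^+ k * (-1) ^+ l))) *+ c.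
Proof.
rewrite (exprNn x) !mulrnAr -mulrnDl; congr (_ *+ c).
move: ((- y) ^+ k) => yNk; ring.
Qed.

Section CharP.
Variables (q : nat) (F : fieldType).
Hypothesis charF : q.+1 \in [pchar F].

Let node (i : 'I_q.+1) : F := (i : nat)%:R.

Lemma natr_ordB (i j : 'I_q.+1) : node (i - j) = node i - node j.
Proof.
apply: (addIr (node j)); rewrite subrK /node -natrD -(GRing.natr_mod_pchar charF).
have -> : (((i - j)%R + j) %% q.+1)%N = val (i - j + j) by [].
by rewrite subrK.
Qed.

Lemma natr_ord_inj : injective node.
Proof.
move=> i j /eqP; rewrite -subr_eq0 -natr_ordB -(dvdn_pcharf charF) => p_dvd.
apply/eqP; rewrite -subr_eq0 -val_eqE /=; apply: contraTT p_dvd => n0.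
by rewrite gtnNdvd // lt0n.
Qed.

(** On functions on Z/p with values in characteristic p, translation and negation
    send i^k to (i - s)^k and (s - i)^k, which are +-i^k up to lower powers of i:
    the reflection matrix is triangular in the monomial basis, the diagonal entry
    of i^k being sum a + (-1)^k sum b.  Putting ones in the first column only
    changes the value on functions that do not vanish at 0, so replacing the
    constant function i^0 by the indicator of 0 removes the factor k = 0 from
    the product. *)
Lemma det_reflection_minor_charp (a b : 'I_q.+1 -> F) :
  \det (col0_ones (reflection_mx a b)) =
    \prod_(k < q) (\sum_s a s + (-1) ^+ k.+1 * \sum_s b s).
Proof.
pose W : 'M[F]_q.+1 := \matrix_(i, k) node i ^+ k.
(* The monomial basis, with the constant function replaced by the indicator
   of 0. *)
pose W0 : 'M[F]_q.+1 := \matrix_(i, k) if k == 0 then (i == 0)%:R else node i ^+ k.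
pose T : 'M[F]_q.+1 := \matrix_(l, k) if k == 0 then (l == 0)%:R else
  (\sum_s (a s * (- node s) ^+ (k - l) +
           b s * (node s ^+ (k - l) * (-1) ^+ l))) *+ 'C(k, l).
have node0 : node 0 = 0 by [].
have E : col0_ones (reflection_mx a b) *m W0 = W *m T.
  apply/matrixP=> i k; rewrite [in LHS]mxE [in RHS]mxE.
  have [->|kn0] := eqVneq k 0.
    rewrite (bigD1 0) //= big1 => [|j jn0]; rewrite !mxE ?eqxx; last first.
      by rewrite (negPf jn0) mulr0.
    rewrite mulr1 addr0 (bigD1 0) //= big1 => [|j jn0]; rewrite !mxE ?eqxx.
      by rewrite expr0 mulr1 addr0.
    by rewrite (negPf jn0) mulr0.
  transitivity (\sum_j reflection_mx a b i j * node j ^+ k).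
    apply: eq_bigr => j _; rewrite !mxE (negPf kn0); case: eqP => [->|//].
    by rewrite node0 expr0n -(inj_eq val_inj) /= in kn0 *; rewrite (negPf kn0) !mulr0.
  rewrite (sum_reflection_mx a b (fun j => node j ^+ k)).
  under [RHS]eq_bigr => l _.
    rewrite !mxE (negPf kn0) mulrnAr mulr_sumr -sumrMnl; over.
  rewrite exchange_big; apply: eq_bigr => s _ /=.
  rewrite !natr_ordB (addrC (node i)) !(exprDn_wide _ _ (ltn_ord k)).
  rewrite !mulr_sumr -big_split; apply: eq_bigr => l _ /=.
  exact: binomial_term_split.
have detW : \det W != 0.
  have -> : W = (Vandermonde q.+1 (\row_i node i))^T.
    by apply/matrixP=> i k; rewrite !mxE.
  by rewrite det_tr; apply/det_Vandermonde_neq0/natr_ord_inj.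
(* Both matrices have first row (1, 0, ..., 0) and differ only in the first
   column. *)
have detW0 : \det W0 = \det W.
  rewrite (expand_det_row W0 0) (expand_det_row W 0).
  rewrite [LHS](bigD1 0) //= [RHS](bigD1 0) //= !big1 => [|j jn0|j jn0].
  - rewrite !mxE eqxx expr0 /cofactor; congr (_ * (_ * \det _) + _).
    by apply/matrixP=> i j; rewrite !mxE.
  - by rewrite !mxE node0 expr0n -[_ == 0%N]/(j == 0) (negPf jn0) mul0r.
  - by rewrite !mxE (negPf jn0) node0 expr0n -[_ == 0%N]/(j == 0) (negPf jn0) mul0r.
have detT : \det T = \prod_(k < q) (\sum_s a s + (-1) ^+ k.+1 * \sum_s b s).
  rewrite -det_tr det_trig; last first.
    apply/is_trig_mxP=> i j ij; rewrite !mxE.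
    case: eqP => [i0|_]; last by rewrite bin_small.
    by rewrite -val_eqE /= gtn_eqF ?(leq_ltn_trans _ ij).
  rewrite big_ord_recl !mxE eqxx mul1r; apply: eq_bigr => k _.
  rewrite !mxE /= binn mulr1n mulr_sumr -big_split; apply: eq_bigr => s _.
  by rewrite subnn !expr0 mulr1 mul1r [b s * _]mulrC.
have := congr1 determinant E; rewrite !det_mulmx detW0 detT mulrC.
exact: mulfI.
Qed.

End CharP.

Lemma map_reflection_mx (R S : nzRingType) (h : {rmorphism R -> S}) q
    (a b : 'I_q.+1 -> R) :
  map_mx h (reflection_mx a b) = reflection_mx (h \o a) (h \o b).
Proof. by apply/matrixP=> i j; rewrite !mxE rmorphD. Qed.

Lemma map_col0_ones (R S : nzRingType) (h : {rmorphism R -> S}) q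
    (P : 'M[R]_q.+1) : map_mx h (col0_ones P) = col0_ones (map_mx h P).
Proof. by apply/matrixP=> i j; rewrite !mxE; case: ifP; rewrite ?rmorph1. Qed.

(** The factors of [det_reflection_minor_charp] are sum a - sum b for k odd and
    sum a + sum b for k even; both kinds occur among k = 1, ..., p - 1 because
    p is at least 3. *)
Lemma dvdz_reflection_minor q (a b : 'I_q.+1 -> int) : prime q.+1 -> (1 < q)%N ->
  (q.+1 %| \det (col0_ones (reflection_mx a b)))%Z =
  (q.+1 %| (\sum_s a s + \sum_s b s) * (\sum_s a s - \sum_s b s))%Z.
Proof.
move=> /pchar_Fp charp q_gt1; rewrite !(dvdz_pcharf charp).
rewrite -det_map_mx map_col0_ones map_reflection_mx det_reflection_minor_charp //.
have sumE (c : 'I_q.+1 -> int) :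
    \sum_s ((intr : int -> 'F_q.+1) \o c) s = (\sum_s c s)%:~R.
  by rewrite rmorph_sum.
rewrite !sumE rmorphM rmorphD rmorphB /= mulf_eq0.
move: (_%:~R) (_%:~R) => s t; apply/idP/idP.
  rewrite prodf_seq_eq0 => /hasP[k _] /=; rewrite -signr_odd.
  by case: (odd _); rewrite ?expr1 ?expr0 ?mulN1r ?mul1r => ->; rewrite ?orbT.
case/orP=> /eqP st0.
  rewrite (bigD1 (Ordinal q_gt1)) //= -signr_odd expr0 mul1r st0 mul0r //.
by rewrite (bigD1 (Ordinal (ltnW q_gt1))) //= expr1 mulN1r st0 mul0r.
Qed.

(** In the factorisation D = (s^2 - t^2) M M', the prime p divides all of
    s^2 - t^2, M and M' as soon as it divides one of them. *)
Lemma dvdz_p3_det_dihedral q (a b : 'I_q.+1 -> int) : prime q.+1 -> (1 < q)%N ->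
  (q.+1 %| \det (dihedral_mx a b))%Z ->
  (q.+1%:Z ^+ 3 %| \det (dihedral_mx a b))%Z.
Proof.
move=> p_prime q_gt1; rewrite det_dihedral_mx.
rewrite !(det_row_sum (reflection_mx_row_sum _ _)) sumrN.
set s := \sum_s a s; set t := \sum_s b s.
have := dvdz_reflection_minor a b p_prime q_gt1.
have := dvdz_reflection_minor a (fun i => - b i) p_prime q_gt1.
rewrite sumrN opprK -/s -/t [_ * (s + t)]mulrC.
set M := \det _; set M' := \det _ => dvdM' dvdM.
have euclid (u v : int) : (q.+1 %| u * v)%Z = (q.+1 %| u)%Z || (q.+1 %| v)%Z.
  by rewrite !(dvdz_pcharf (pchar_Fp p_prime)) rmorphM mulf_eq0.
rewrite mulrACA => dvdD.
have dvd_st : (q.+1 %| (s + t) * (s - t))%Z.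
  apply: contraLR dvdD => not_st; rewrite euclid (negPf not_st) /=.
  by rewrite euclid dvdM dvdM' orbb.
by rewrite exprS expr2 !dvdz_mul ?dvdM ?dvdM'.
Qed.

(** The two factors A + B and A - B are congruent modulo 2, so both determinants
    are even as soon as one is. *)
Lemma dvdz_4_det_dihedral q (a b : 'I_q.+1 -> int) :
  (2 %| \det (dihedral_mx a b))%Z -> (2%:Z ^+ 2 %| \det (dihedral_mx a b))%Z.
Proof.
have char2 : 2 \in [pchar 'F_2] by apply: pchar_Fp.
rewrite det_dihedral_mx.
have E : (2 %| \det (reflection_mx a (fun i => - b i)))%Z =
    (2 %| \det (reflection_mx a b))%Z.
  rewrite !(dvdz_pcharf char2) -!det_map_mx; congr (\det _ == 0).
  apply/matrixP=> i j; rewrite !mxE !rmorphD rmorphN /=; congr (_ + _).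
  by rewrite oppr_pchar2.
rewrite (dvdz_pcharf char2) rmorphM mulf_eq0 -!(dvdz_pcharf char2) E orbb => ev.
by rewrite expr2 dvdz_mul // E.
Qed.

Lemma factor_2_p p (D : int) : prime p -> odd p -> D != 0 ->
  ((2 %| D)%Z -> (2%:Z ^+ 2 %| D)%Z) -> ((p %| D)%Z -> (p%:Z ^+ 3 %| D)%Z) ->
  exists (a b : nat) (m : int),
     [/\ D = 2%:Z ^+ a * p%:Z ^+ b * m, gcdz m (2 * p)%N%:Z = 1,
         a = 0%N \/ (2 <= a)%N & b = 0%N \/ (3 <= b)%N].
Proof.
move=> p_prime p_odd D0; rewrite !dvdzE !abszX /= => dvd2 dvdp.
have n_gt0 : (0 < `|D|)%N by rewrite absz_gt0.
have [m1 co2m1 Dm1] := pfactor_coprime (isT : prime 2) n_gt0.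
have m1_gt0 : (0 < m1)%N by move: n_gt0; rewrite Dm1 muln_gt0 => /andP[].
have [m2 copm2 m1E] := pfactor_coprime p_prime m1_gt0.
set a := logn 2 _ in Dm1; set b := logn p m1 in m1E.
have co2m2 : coprime 2 m2 by move: co2m1; rewrite m1E coprimeMr => /andP[].
have cop2 k l : coprime (p ^ k) (2 ^ l).
  by rewrite coprimeXl // coprimeXr // coprime_sym coprime2n.
exists a, b, ((-1) ^+ (D < 0)%R * m2%:Z); split.
- rewrite {1}[D]intEsign {1}Dm1 m1E !PoszM -(natz (p ^ b)) -(natz (2 ^ a)) !natrX !natz.
  ring.
- rewrite /gcdz abszMsign -/(coprime _ _) /=; congr Posz.
  by apply/eqP; rewrite -/(coprime _ _) coprimeMr coprime_sym co2m2 coprime_sym.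
- have [->|] := posnP a; [by left | right].
  have : (4 %| `|D|)%N; last first.
    by rewrite (@pfactor_dvdn 2 2).
  by apply: dvd2; rewrite Dm1 dvdn_mull // dvdn_exp.
- have [->|b_gt0] := posnP b; [by left | right].
  have : (p ^ 3 %| `|D|)%N.
    by apply: dvdp; rewrite Dm1 m1E dvdn_mulr // dvdn_mull // dvdn_exp.
  by rewrite Dm1 Gauss_dvdl ?cop2 // pfactor_dvdn.
Qed.

(** * Fourier diagonalisation of the dihedral matrix *)

(** As the blocks commute, multiplying on the right by the block matrix with rows
    (d, 0) and (-c, 1) makes the product block triangular; it then remains to
    cancel det d. *)
Lemma det_block_diag_idomain (R : idomainType) n (a b c d : 'rV[R]_n) :
  (forall k, d 0 k != 0) ->
  \det (block_mx (diag_mx a) (diag_mx b) (diag_mx c) (diag_mx d)) =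
    \prod_k (a 0 k * d 0 k - b 0 k * c 0 k).
Proof.
move=> d_neq0.
have prod_d : \det (diag_mx d) != 0.
  by rewrite det_diag prodf_seq_neq0; apply/allP=> k _; apply: d_neq0.
pose e : 'rV[R]_n := \row_k (a 0 k * d 0 k - b 0 k * c 0 k).
have E : block_mx (diag_mx a) (diag_mx b) (diag_mx c) (diag_mx d) *m
    block_mx (diag_mx d) 0 (- diag_mx c) 1%:M =
    block_mx (diag_mx e) (diag_mx b) 0 (diag_mx d).
  rewrite mulmx_block !(mulmx1, mulmx0, mulmxN, add0r) !mulmx_diag.
  rewrite -!linearB /=; congr block_mx.
    by congr diag_mx; apply/rowP=> k; rewrite !mxE.
  by rewrite -[RHS](linear0 diag_mx); congr diag_mx;
    apply/rowP=> k; rewrite !mxE mulrC subrr.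
have := congr1 determinant E.
rewrite det_mulmx det_lblock det1 mulr1 det_ublock => /(mulIf prod_d) ->.
by rewrite det_diag; apply: eq_bigr => k _; rewrite mxE.
Qed.

(** Replacing d by 'X + d makes its entries nonzero in the polynomial ring;
    evaluation at 0 recovers the general case. *)
Lemma det_block_diag (R : idomainType) n (a b c d : 'rV[R]_n) :
  \det (block_mx (diag_mx a) (diag_mx b) (diag_mx c) (diag_mx d)) =
    \prod_k (a 0 k * d 0 k - b 0 k * c 0 k).
Proof.
pose ev : {rmorphism {poly R} -> R} := horner_eval 0.
pose dX : 'rV[{poly R}]_n := \row_k ('X + (d 0 k)%:P).
have dX0 k : dX 0 k != 0 by rewrite mxE -size_poly_eq0 size_XaddC.
have := det_block_diag_idomain (map_mx polyC a) (map_mx polyC b) (map_mx polyC c) dX0.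
move/(congr1 ev); rewrite -det_map_mx map_block_mx !map_diag_mx rmorph_prod.
have evC (u : 'rV[R]_n) : map_mx ev (map_mx polyC u) = u.
  by apply/rowP=> k; rewrite !mxE /= /horner_eval hornerC.
have evX : map_mx ev dX = d.
  by apply/rowP=> k; rewrite !mxE /= /horner_eval !hornerE.
rewrite !evC evX => ->; apply: eq_bigr => k _.
by rewrite !mxE /= /horner_eval !hornerE.
Qed.

Section Fourier.
Variables (F : fieldType) (q : nat) (z : F).
Hypothesis z_prim : q.+1.-primitive_root z.

Definition fourier (a : 'I_q.+1 -> F) (y : F) := \sum_s a s * y ^+ s.

Lemma root_unity_neq0 (y : F) : y ^+ q.+1 = 1 -> y != 0.
Proof.
by move=> yp; apply: contra_eq_neq yp => ->; rewrite expr0n eq_sym oner_eq0.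
Qed.

Lemma expr_ordB (y : F) (i j : 'I_q.+1) : y ^+ q.+1 = 1 ->
  y ^+ (i - j)%R = y ^+ i * y^-1 ^+ j.
Proof.
move=> yp; have y0 := root_unity_neq0 yp.
apply: (mulIf (expf_neq0 j y0)); rewrite -mulrA -exprMn mulVf // expr1n mulr1.
rewrite -exprD -[LHS](expr_mod _ yp).
have -> : (((i - j)%R + j) %% q.+1)%N = val (i - j + j) by [].
by rewrite subrK.
Qed.

Lemma fourier_circ a (y : F) i : y ^+ q.+1 = 1 ->
  \sum_j circ_mx a i j * y ^+ j = y ^+ i * fourier a y^-1.
Proof.
move=> yp; under eq_bigr => j _ do rewrite mxE.
rewrite (sum_circ a (fun j => y ^+ j)) mulr_sumr.
by apply: eq_bigr => s _; rewrite expr_ordB // mulrCA.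
Qed.

Lemma fourier_anticirc b (y : F) i : y ^+ q.+1 = 1 ->
  \sum_j anticirc_mx b i j * y ^+ j = y^-1 ^+ i * fourier b y.
Proof.
move=> yp; under eq_bigr => j _ do rewrite mxE.
rewrite (sum_anticirc b (fun j => y ^+ j)) mulr_sumr.
by apply: eq_bigr => s _; rewrite expr_ordB // mulrA mulrC.
Qed.

Lemma prim_expr_inj : injective (fun k : 'I_q.+1 => z ^+ k).
Proof.
move=> i j /eqP; rewrite (eq_prim_root_expr z_prim) !modn_small // => /eqP.
exact: val_inj.
Qed.

(** Circulant matrices are diagonal in the basis of characters, and the matrices
    b_(i+j) exchange the characters of y and 1/y.  Taking conjugate characters
    for the two halves of the block matrix therefore makes all four blocks
    diagonal. *)
Lemma det_dihedral_fourier (a b : 'I_q.+1 -> F) :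
  \det (dihedral_mx a b) = \prod_(k < q.+1)
    (fourier a (z ^+ k) * fourier a (z ^+ k)^-1 -
     fourier b (z ^+ k) * fourier b (z ^+ k)^-1).
Proof.
pose V := Vandermonde q.+1 (\row_(k < q.+1) z ^+ k).
pose V' := Vandermonde q.+1 (\row_(k < q.+1) (z ^+ k)^-1).
have V0 : \det V != 0 by apply/det_Vandermonde_neq0/prim_expr_inj.
have V'0 : \det V' != 0.
  by apply: det_Vandermonde_neq0 => i j /invr_inj /prim_expr_inj.
pose S c : 'rV[F]_q.+1 := \row_k fourier c (z ^+ k).
pose S' c : 'rV[F]_q.+1 := \row_k fourier c (z ^+ k)^-1.
have zp (k : 'I_q.+1) : (z ^+ k) ^+ q.+1 = 1.
  by rewrite exprAC (prim_expr_order z_prim) expr1n.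
have z'p (k : 'I_q.+1) : (z ^+ k)^-1 ^+ q.+1 = 1 by rewrite exprVn zp invr1.
have aV : circ_mx a *m V = V *m diag_mx (S' a).
  rewrite mul_mx_diag; apply/matrixP=> i k; rewrite !mxE -fourier_circ //.
  by apply: eq_bigr => j _; rewrite !mxE.
have aV' : circ_mx a *m V' = V' *m diag_mx (S a).
  rewrite mul_mx_diag; apply/matrixP=> i k; rewrite !mxE.
  rewrite -{2}[z ^+ k]invrK -fourier_circ //.
  by apply: eq_bigr => j _; rewrite !mxE.
have bV : anticirc_mx b *m V = V' *m diag_mx (S b).
  rewrite mul_mx_diag; apply/matrixP=> i k; rewrite !mxE -fourier_anticirc //.
  by apply: eq_bigr => j _; rewrite !mxE.
have bV' : anticirc_mx b *m V' = V *m diag_mx (S' b).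
  rewrite mul_mx_diag; apply/matrixP=> i k; rewrite !mxE.
  rewrite -{1}[z ^+ k]invrK -fourier_anticirc //.
  by apply: eq_bigr => j _; rewrite !mxE.
have E : dihedral_mx a b *m block_mx V' 0 0 V = block_mx V' 0 0 V *m
    block_mx (diag_mx (S a)) (diag_mx (S b)) (diag_mx (S' b)) (diag_mx (S' a)).
  by rewrite !mulmx_block !(mulmx0, mul0mx, addr0, add0r) aV aV' bV bV'.
have W0 : \det (block_mx V' 0 0 V) != 0 by rewrite det_ublock mulf_neq0.
have := congr1 determinant E; rewrite !det_mulmx mulrC => /(mulfI W0) ->.
by rewrite det_block_diag; apply: eq_bigr => k _; rewrite !mxE.
Qed.

Definition nontrivial_prod (H : F -> F) : F :=
  \prod_(k < q.+1 | k != 0) H (z ^+ k).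

Local Notation N := nontrivial_prod.

Lemma eq_nontrivial_prod H H' :
  (forall y, y ^+ q.+1 = 1 -> y != 1 -> H y = H' y) -> N H = N H'.
Proof.
move=> eqH; apply: eq_bigr => k k0; apply: eqH.
  by rewrite exprAC (prim_expr_order z_prim) expr1n.
by rewrite -(expr0 z) (inj_eq prim_expr_inj k 0).
Qed.

Lemma nontrivial_prodM H H' : N (fun y => H y * H' y) = N H * N H'.
Proof. exact: big_split. Qed.

(** For c prime to p, raising to the power c permutes the nontrivial p-th roots of
    unity. *)
Lemma nontrivial_prod_expr H c : coprime c q.+1 ->
  N (fun y => H (y ^+ c)) = N H.
Proof.
move=> co_c; pose h (k : 'I_q.+1) : 'I_q.+1 := inZp (c * k).
have h_inj : injective h.
  move=> i j /(congr1 val) /=; wlog le_ij : i j / (i <= j)%N => [th eq_ij|].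
    by case/orP: (leq_total i j) => le_ij; [|apply/esym]; apply: th.
  move/eqP; rewrite eq_sym eqn_mod_dvd ?leq_mul2l ?le_ij ?orbT // -mulnBr.
  rewrite Gauss_dvdr 1?coprime_sym // => d.
  apply/val_inj/eqP; rewrite eqn_leq le_ij -subn_eq0; apply: contraTT d => n0.
  by rewrite gtnNdvd ?lt0n // (leq_ltn_trans (leq_subr _ _)).
rewrite /N [RHS](reindex_inj h_inj); apply: eq_big => [k|k _].
  by rewrite -(inj_eq h_inj); congr (_ != _); apply/val_inj; rewrite /= muln0 mod0n.
by rewrite /= (prim_expr_mod z_prim) mulnC exprM.
Qed.

Lemma nontrivial_prodV H : N (fun y => H y^-1) = N H.
Proof.
have co : coprime q q.+1 by rewrite coprimenS.
rewrite -[RHS](nontrivial_prod_expr _ co); apply: eq_nontrivial_prod => y yp _.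
congr H; have y0 := root_unity_neq0 yp.
by apply: (mulfI y0); rewrite mulfV // -exprS.
Qed.

(** Squaring permutes the roots of unity, so the product is equal to its
    square. *)
Lemma nontrivial_prod_id : odd q.+1 -> N id = 1.
Proof.
move=> p_odd; have co2 : coprime 2 q.+1 by rewrite coprime2n.
have := nontrivial_prod_expr id co2.
rewrite (eq_nontrivial_prod (H' := fun y => y * y)) => [|y _ _]; last by rewrite expr2.
rewrite nontrivial_prodM -[RHS]mulr1 => /mulfI; apply.
rewrite prodf_seq_neq0; apply/allP=> k _; apply/implyP=> _.
by rewrite expf_neq0 // (prim_root_eq0 z_prim).
Qed.

(** The polynomial 1 + X + ... + X^(p-1) has the nontrivial roots of unity as its
    roots; evaluate it at 1. *)
Lemma nontrivial_prod_sub1 : N (fun y => 1 - y) = q.+1%:R.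
Proof.
have := factor_Xn_sub_1 z_prim; rewrite subrX1 big_mkord big_ord_recl expr0.
move/(mulfI (negbT (polyXsubC_eq0 1))) /(congr1 (horner^~ 1)).
have -> : (\sum_(i < q.+1) 'X^i).[1] = q.+1%:R :> F.
  rewrite horner_sum -[in RHS](card_ord q.+1) -sumr_const.
  by apply: eq_bigr => k _; rewrite hornerXn expr1n.
rewrite horner_prod => <-; rewrite /nontrivial_prod big_mkcond big_ord_recl /= mul1r.
by apply: eq_bigr => k _; rewrite !hornerE.
Qed.

End Fourier.

(** * Sufficiency: prescribed values at 1 and norms at the other roots of unity *)

(** The coefficients of the reduction of f modulo X^p - 1, so that a group ring
    element can be given by a polynomial of any degree. *)
Definition wrap_coef q (f : {poly int}) (s : 'I_q.+1) : int :=
  \sum_(i < size f | (i %% q.+1)%N == s) f`_i.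

Definition ipoly_eval (R : nzRingType) (f : {poly int}) (y : R) : R :=
  (map_poly intr f).[y].

(** The determinant of the two-dimensional representation attached to y, at the
    group ring element given by f and g. *)
Definition dihedral_norm (f g : {poly int}) (y : algC) : algC :=
  ipoly_eval f y * ipoly_eval f y^-1 - ipoly_eval g y * ipoly_eval g y^-1.

Lemma fourier_wrap_coef (F : fieldType) q (f : {poly int}) (y : F) : y ^+ q.+1 = 1 ->
  fourier (fun s : 'I_q.+1 => (wrap_coef f s)%:~R) y = ipoly_eval f y.
Proof.
move=> yp; rewrite /ipoly_eval (horner_coef_wide _ (size_poly _ _)).
rewrite (partition_big (fun i : 'I_(size f) => inord (i %% q.+1) : 'I_q.+1) predT) //=.
apply: eq_bigr => s _; rewrite rmorph_sum mulr_suml; apply: eq_big => i.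
  by rewrite -(inj_eq val_inj) /= inordK // ltn_mod.
by rewrite coef_map -(expr_mod i yp) => /eqP <-.
Qed.

Lemma det_dihedral_wrap q (z : algC) (f g : {poly int}) : q.+1.-primitive_root z ->
  (\det (dihedral_mx (wrap_coef (q := q) f) (wrap_coef g)))%:~R =
  (f.[1] ^+ 2 - g.[1] ^+ 2)%:~R * nontrivial_prod q z (dihedral_norm f g).
Proof.
move=> z_prim; rewrite -det_map_mx.
have -> : map_mx intr (dihedral_mx (wrap_coef (q := q) f) (wrap_coef g)) =
    dihedral_mx (fun s => (wrap_coef f s)%:~R : algC) (fun s => (wrap_coef g s)%:~R).
  rewrite map_block_mx; congr block_mx; apply/matrixP=> i j; rewrite !mxE //.
rewrite (det_dihedral_fourier z_prim) (bigD1 0) //=; congr (_ * _).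
  rewrite expr0 invr1 !fourier_wrap_coef ?expr1n // /ipoly_eval.
  by rewrite -[1](rmorph1 (intr : int -> algC)) !horner_map /= -!expr2 rmorphB !rmorphXn.
apply: eq_bigr => k _; have zp : (z ^+ k) ^+ q.+1 = 1.
  by rewrite exprAC (prim_expr_order z_prim) expr1n.
by rewrite !fourier_wrap_coef // exprVn zp invr1.
Qed.

Definition geom k : {poly int} := \sum_(i < k) 'X^i.

Lemma geom1 k : (geom k).[1] = k%:Z.
Proof.
rewrite horner_sum -[in RHS](card_ord k) -[RHS]natz -sumr_const.
by apply: eq_bigr => i _; rewrite hornerXn expr1n.
Qed.

Lemma ipoly_eval_geom (R : comNzRingType) k (y : R) :
  (1 - y) * ipoly_eval (geom k) y = 1 - y ^+ k.
Proof.
rewrite /ipoly_eval rmorph_sum horner_sum -[in RHS]opprB subrX1 -mulNr opprB.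
by congr (_ * _); apply: eq_bigr => i _; rewrite /= map_polyXn hornerXn.
Qed.

(** Adding multiples of [geom p], which vanishes at the nontrivial p-th roots of
    unity and equals p at 1, moves f(1) and g(1) inside their residue classes and
    leaves the other factors unchanged. *)
Lemma realize_norm q (z : algC) (f g : {poly int}) (s t M : int) :
    q.+1.-primitive_root z ->
    (q.+1 %| s - f.[1])%Z -> (q.+1 %| t - g.[1])%Z ->
    nontrivial_prod q z (dihedral_norm f g) = M%:~R ->
  exists a b : 'I_q.+1 -> int,
    \det (dihedral_mx a b) = (s ^+ 2 - t ^+ 2) * M.
Proof.
move=> z_prim /dvdzP[u su] /dvdzP[v tv] normM.
pose f' := f + u%:P * geom q.+1; pose g' := g + v%:P * geom q.+1.
have evD (h : {poly int}) w (y : algC) : y ^+ q.+1 = 1 -> y != 1 ->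
    ipoly_eval (h + w%:P * geom q.+1) y = ipoly_eval h y.
  move=> yp y1; rewrite /ipoly_eval rmorphD rmorphM /= hornerD hornerM.
  suff -> : (map_poly intr (geom q.+1)).[y] = 0 by rewrite mulr0 addr0.
  have y1' : 1 - y != 0 by rewrite subr_eq0 eq_sym.
  by apply: (mulfI y1'); rewrite ipoly_eval_geom yp subrr mulr0.
exists (wrap_coef f'), (wrap_coef g').
apply: (@intr_inj algC); rewrite (det_dihedral_wrap _ _ z_prim) rmorphM /= -normM.
congr (_%:~R * _).
  by rewrite !hornerD !hornerM !hornerC geom1 -su -tv !(addrC _ (_ - _)) !subrK.
apply: (eq_nontrivial_prod z_prim) => y yp y1; rewrite /dihedral_norm.
have yVp : y^-1 ^+ q.+1 = 1 by rewrite exprVn yp invr1.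
by rewrite !evD ?invr_eq1.
Qed.

Section Families.
Variables (q : nat) (z : algC).
Hypothesis p_odd : odd q.+1.
Hypothesis z_prim : q.+1.-primitive_root z.

Local Notation N := (nontrivial_prod q z).

Let p_neq0 : q.+1%:R != 0 :> algC.
Proof. by rewrite pnatr_eq0. Qed.

Lemma norm_1BX c : coprime c q.+1 -> N (fun y => 1 - y ^+ c) = q.+1%:R.
Proof.
by move=> co; rewrite (nontrivial_prod_expr z_prim (fun y => 1 - y) co)
  (nontrivial_prod_sub1 z_prim).
Qed.

(** The value of [geom c] at y is the cyclotomic unit (1 - y^c) / (1 - y). *)
Lemma norm_geom c : coprime c q.+1 -> N (ipoly_eval (geom c)) = 1.
Proof.
move=> co; apply: (mulfI p_neq0); rewrite mulr1 -[in RHS](norm_1BX co).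
rewrite -{1}(nontrivial_prod_sub1 z_prim) -nontrivial_prodM.
by apply: eq_bigr => k _; rewrite ipoly_eval_geom.
Qed.

Lemma norm_exp (H : algC -> algC) k : N (fun y => H y ^+ k) = N H ^+ k.
Proof. by rewrite /nontrivial_prod prodrXl. Qed.

Lemma norm_inv : N (fun y => y^-1) = 1.
Proof. by rewrite (nontrivial_prodV z_prim id) nontrivial_prod_id. Qed.

(** The identity
    (1 - y)^2 h(y) / y = y^-(m+k) (1 - y^m) (1 - y^(m+2k))
    shows that h(y) is a unit for y <> 1 when m and m + 2k are prime to p. *)
Lemma dihedral_norm_geom m k : coprime m q.+1 -> coprime (m + k.*2) q.+1 ->
  N (dihedral_norm (geom (m + k)) (geom k)) = 1.
Proof.
move=> co_m co_mk; apply: (mulfI p_neq0); apply: (mulfI p_neq0); rewrite mulr1.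
pose rhs y : algC := y^-1 ^+ (m + k) * ((1 - y ^+ m) * (1 - y ^+ (m + k.*2))).
transitivity (N rhs); last first.
  by rewrite !nontrivial_prodM norm_exp norm_inv expr1n mul1r !norm_1BX.
rewrite -(nontrivial_prod_sub1 z_prim) -[LHS]mul1r -{1}norm_inv.
rewrite -!nontrivial_prodM.
apply: (eq_nontrivial_prod z_prim) => y /root_unity_neq0 y0 _.
rewrite /rhs /dihedral_norm.
have gE j := ipoly_eval_geom j y; have gE' j := ipoly_eval_geom j y^-1.
transitivity (- ((1 - y ^+ (m + k)) * (1 - y^-1 ^+ (m + k)) -
                (1 - y ^+ k) * (1 - y^-1 ^+ k))).
  rewrite -!gE -!gE'; move: (mulVf y0) => Ey; move: (y^-1) Ey => y' Ey.
  by ring: Ey.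
rewrite -addnn !exprD.
have Em : y ^+ m * y^-1 ^+ m = 1 by rewrite -exprMn mulfV ?expr1n.
have Ek : y ^+ k * y^-1 ^+ k = 1 by rewrite -exprMn mulfV ?expr1n.
move: (y ^+ m) (y ^+ k) (y^-1 ^+ m) (y^-1 ^+ k) Em Ek => a b a' b' Ea Eb.
by ring: Ea Eb.
Qed.

Lemma dihedral_norm_1BX : N (dihedral_norm (1 - 'X) 0) = (q.+1 ^ 2)%:R.
Proof.
rewrite natrX expr2 -(nontrivial_prod_sub1 z_prim).
rewrite -{2}(nontrivial_prodV z_prim (fun y => 1 - y)) -nontrivial_prodM.
apply: eq_bigr => k _; rewrite /dihedral_norm /ipoly_eval.
by rewrite rmorph0 rmorphB rmorph1 /= map_polyX !hornerE ?mulr0 ?subr0.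
Qed.

(** With w = [geom c], 'X^q stands for 1/y and
    h(y) = w(y) w(1/y) (1 - (y + 1/y - 1)^2)
         = w(y) w(1/y) (1 - y) (1 - 1/y) (y + 1/y),
    where y + 1/y = (1 - y^4) / (y (1 - y^2)) is a unit.  The factor w leaves the
    norm unchanged and makes the values at 1 arbitrary modulo p. *)
Lemma dihedral_norm_reflect c : coprime c q.+1 ->
  N (dihedral_norm (geom c) (('X + 'X^q - 1) * geom c)) = (q.+1 ^ 2)%:R.
Proof.
move=> co_c; apply: (mulfI p_neq0).
have co2 : coprime 2 q.+1 by rewrite coprime2n.
have co4 : coprime 4 q.+1 by rewrite (coprimeXl 2 co2).
transitivity (N (fun y => ipoly_eval (geom c) y * ipoly_eval (geom c) y^-1 *
    ((1 - y) * (1 - y^-1) * (1 - y ^+ 4)))); last first.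
  rewrite !nontrivial_prodM (nontrivial_prodV z_prim (ipoly_eval (geom c))).
  rewrite (nontrivial_prodV z_prim (fun y => 1 - y)) norm_geom // norm_1BX //.
  by rewrite !(nontrivial_prod_sub1 z_prim) !mul1r mulrC natrX expr2.
rewrite -{1}(norm_1BX co2) -[LHS]mul1r -{1}(nontrivial_prod_id z_prim p_odd).
rewrite -!nontrivial_prodM.
apply: (eq_nontrivial_prod z_prim) => y yp _; have y0 := root_unity_neq0 yp.
have yq : y ^+ q = y^-1 by apply: (mulfI y0); rewrite mulfV // -exprS.
have yVq : y^-1 ^+ q = y by rewrite exprVn yq invrK.
have gE (u : algC) : ipoly_eval (('X + 'X^q - 1) * geom c) u =
    (u + u ^+ q - 1) * ipoly_eval (geom c) u.
  rewrite /ipoly_eval rmorphM rmorphB rmorphD rmorph1 /= map_polyX map_polyXn.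
  by rewrite !hornerE.
rewrite /dihedral_norm !gE yq yVq.
move: (mulVf y0) => Ey; move: (y^-1) Ey => y' Ey.
move: (ipoly_eval _ y) (ipoly_eval _ y') => w w'.
by ring: Ey.
Qed.

End Families.

Lemma nat_representative p (k : int) n : (0 < p)%N ->
  exists2 k0 : nat, (n <= k0)%N & (p %| k - k0%:Z)%Z.
Proof.
move=> p_gt0; exists (`|(k %% p)%Z| + n * p)%N.
  by apply: leq_trans (leq_addl _ _); rewrite leq_pmulr.
rewrite PoszD PoszM gez0_abs ?modz_ge0 ?eqz_nat -?lt0n //.
rewrite {1}(divz_eq k p) opprD addrA addrK -mulrBl.
exact: dvdz_mull.
Qed.

Section Values.
Variables (q : nat) (z : algC).
Hypotheses (p_prime : prime q.+1) (p_odd : odd q.+1).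
Hypothesis z_prim : q.+1.-primitive_root z.

Let coprime_p (c : nat) : ~~ (q.+1 %| c%:Z)%Z -> coprime c q.+1.
Proof. by rewrite coprime_sym prime_coprime. Qed.

(** The conditions of [dihedral_norm_geom] on m = k - l and m + 2l = k + l hold
    for nonnegative representatives k0 >= l0 of k and l modulo p. *)
Lemma dihedral_value_p0 (k l : int) : ~~ (q.+1 %| k ^+ 2 - l ^+ 2)%Z ->
  exists a b : 'I_q.+1 -> int, \det (dihedral_mx a b) = k ^+ 2 - l ^+ 2.
Proof.
move=> ndvd.
have [l0 _ dvd_l] := nat_representative l 0 (prime_gt0 p_prime).
have [k0 le_lk dvd_k] := nat_representative k l0 (prime_gt0 p_prime).
pose m := (k0 - l0)%N; have k0E : k0 = (m + l0)%N by rewrite subnK.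
have ndvdBD : ~~ (q.+1 %| k - l)%Z /\ ~~ (q.+1 %| k + l)%Z.
  by split; apply: contra ndvd; rewrite subr_sqr; [apply: dvdz_mulr|apply: dvdz_mull].
have co_m : coprime m q.+1.
  apply/coprime_p; apply: contra ndvdBD.1 => dvd_m.
  have -> : k - l = k - k0%:Z - (l - l0%:Z) + m%:Z by rewrite k0E PoszD; ring.
  by apply: rpredD => //; apply: rpredB.
have co_ml : coprime (m + l0.*2) q.+1.
  apply/coprime_p; apply: contra ndvdBD.2 => dvd_m.
  have -> : k + l = k - k0%:Z + (l - l0%:Z) + (m + l0.*2)%N%:Z.
    by rewrite k0E -addnn !PoszD; ring.
  by apply: rpredD => //; apply: rpredD.
have normE := dihedral_norm_geom p_odd z_prim co_m co_ml.
rewrite -[k ^+ 2 - _]mulr1.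
by apply: (realize_norm (M := 1) z_prim _ _ normE); rewrite geom1 -?k0E.
Qed.

(** Here f(1) = g(1) = c mod p for a chosen c, so f(1) - g(1) is a multiple of p
    and supplies the third factor p.  With p = 2r + 1, the values
    e = k + r (k - l) and e - p (k - l) have difference p (k - l) and
    sum k + l. *)
Lemma dihedral_value_p3 (k l : int) : ~~ (q.+1 %| k + l)%Z ->
  exists a b : 'I_q.+1 -> int,
    \det (dihedral_mx a b) = q.+1%:Z ^+ 3 * (k ^+ 2 - l ^+ 2).
Proof.
move=> ndvd; pose r := (q./2)%:Z; pose e := k + r * (k - l).
have pE : q.+1%:Z = 2 * r + 1.
  rewrite /r -[q in LHS]odd_double_half; move: p_odd => /= /negPf ->.
  by rewrite add0n -muln2 -addn1 PoszD PoszM mulrC.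
have e2 : 2 * e = k + l + q.+1%:Z * (k - l) by rewrite pE /e; ring.
have [c _ dvd_c] := nat_representative e 0 (prime_gt0 p_prime).
have co_c : coprime c q.+1.
  apply/coprime_p; apply: contra ndvd => dvd_pc.
  have -> : k + l = 2 * (e - c%:Z) + 2 * c%:Z - q.+1%:Z * (k - l).
    by rewrite -[k + l](addrK (q.+1%:Z * (k - l))) -e2; ring.
  apply: rpredB; last exact: dvdz_mulr.
  by apply: rpredD; apply: dvdz_mull.
have normE := dihedral_norm_reflect p_odd z_prim co_c.
have [||a [b ab]] := realize_norm (M := (q.+1 ^ 2)%N) (s := e)
  (t := e - q.+1%:Z * (k - l)) z_prim _ _ normE.
- by rewrite geom1.
- rewrite hornerM !hornerE geom1 expr1n addrK mul1r addrAC.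
  by apply: rpredB; rewrite ?dvdz_mulr.
exists a, b; rewrite ab -(natz (q.+1 ^ 2)) natrX natz.
have -> : k ^+ 2 - l ^+ 2 = (2 * e - q.+1%:Z * (k - l)) * (k - l).
  by rewrite e2; ring.
ring.
Qed.

(** For f = 1 - X and g = 0 both values at 1 are 0, so multiples p k and p l can
    be prescribed; the norm contributes the other factor p^2. *)
Lemma dihedral_value_p4 (k l : int) : exists a b : 'I_q.+1 -> int,
  \det (dihedral_mx a b) = q.+1%:Z ^+ 4 * (k ^+ 2 - l ^+ 2).
Proof.
have normE := dihedral_norm_1BX z_prim.
have [||a [b ab]] :=
  realize_norm (M := (q.+1 ^ 2)%N) (s := q.+1%:Z * k) (t := q.+1%:Z * l)
    z_prim _ _ normE.
- by rewrite !hornerE ?subrr ?subr0 dvdz_mulr.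
- by rewrite !hornerE ?subr0 dvdz_mulr.
by exists a, b; rewrite ab -(natz (q.+1 ^ 2)) natrX natz; ring.
Qed.

End Values.

Lemma diff_of_squares (n : int) : ~~ (2 %| n)%Z || (4 %| n)%Z ->
  exists k l : int, n = k ^+ 2 - l ^+ 2.
Proof.
case/orP=> [odd_n|/dvdzP[e ->]]; last by exists (e + 1), (e - 1); ring.
have /dvdzP[e ne] : (2 %| n - 1)%Z by lia.
exists (e + 1), e; rewrite -[n](subrK 1) ne; ring.
Qed.

Theorem theorem5p1 (p : nat) (p_prime : prime p) (p_odd : odd p) (D : int) :
  (D != 0 /\ exists x : 'D_(2 * p) -> int, group_det x = D) <->
  (exists (a b : nat) (m : int),
     [/\ D = 2%:Z ^+ a * p%:Z ^+ b * m,
         gcdz m (2 * p)%N%:Z = 1,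
         a = 0%N \/ (2 <= a)%N
       & b = 0%N \/ (3 <= b)%N]).
Proof.
case: p p_prime p_odd => // q p_prime p_odd.
have q_gt1 : (1 < q)%N by case: q p_prime p_odd => [|[|]].
rewrite group_det_dihedral ?(ltnW q_gt1) //; split.
  case=> D0 [a [b abD]]; apply: factor_2_p => //; rewrite -abD.
    exact: dvdz_4_det_dihedral.
  exact: dvdz_p3_det_dihedral.
case=> [a [b [m [-> co_m a_val b_val]]]].
have [z z_prim] := C_prim_root_exists (prime_gt0 p_prime).
have co_m2p : coprime `|m| (2 * q.+1) by move: co_m => [] /eqP.
move: co_m2p; rewrite coprimeMr => /andP[co_m2 co_mp].
have p_ndvd j : ~~ (q.+1 %| 2%:Z ^+ j * m)%Z.
  rewrite dvdzE abszM abszX /= -prime_coprime // coprimeMr coprimeXr ?coprimen2 //=.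
  by rewrite coprime_sym.
have odd_or_4 j : ~~ (2 %| q.+1%:Z ^+ j * (2%:Z ^+ a * m))%Z ||
    (4 %| q.+1%:Z ^+ j * (2%:Z ^+ a * m))%Z.
  apply/orP; case: a_val => [->|a_ge2]; [left|right].
    rewrite expr0 mul1r dvdzE abszM abszX /= -prime_coprime // coprimeMr.
    by rewrite [X in _ && X]coprime_sym co_m2 andbT coprimeXr // coprime2n.
  by rewrite dvdz_mull // dvdz_mulr // -(subnKC a_ge2) exprD dvdz_mulr.
split.
  rewrite mulf_neq0 //; first by rewrite mulf_neq0 ?expf_neq0.
  by apply: contraTneq co_m2 => ->; rewrite /coprime gcd0n.
rewrite mulrAC mulrC; case: b_val => [->|b_ge3].
  rewrite expr0 mul1r; have := odd_or_4 0%N; rewrite expr0 mul1r.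
  case/diff_of_squares=> k [l E]; move: (p_ndvd a); rewrite E => ndvd.
  exact: (dihedral_value_p0 p_prime p_odd z_prim).
have [b3|b_neq3] := eqVneq b 3.
  have := odd_or_4 0%N; rewrite expr0 mul1r b3.
  case/diff_of_squares=> k [l E]; move: (p_ndvd a); rewrite E => ndvd.
  apply: (dihedral_value_p3 p_prime p_odd z_prim); apply: contra ndvd.
  by rewrite subr_sqr; apply: dvdz_mull.
have b_ge4 : (4 <= b)%N by rewrite ltn_neqAle eq_sym b_neq3.
rewrite -(subnKC b_ge4) exprD -mulrA.
have [k [l ->]] := diff_of_squares (odd_or_4 (b - 4)%N).
exact: dihedral_value_p4 z_prim k l.
Qed.
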